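(* Each Taimanov semigroup $T$ is algebraically complete in the class of square-topological semigroups satisfying the separation axiom $T_1$. In particular, $T$ is algebraically complete in the class of topological semigroups satisfying the separation axiom $T_1$.
   Context: A semigroup $T$ is called a Taimanov semigroup if it contains two distinct elements $0_T,\infty_T$ such that for any $x,y\in T$: $x\cdot y=\infty_T$ if $x\ne y$ and $x,y\in T\setminus\{0_T,\infty_T\}$; and $x\cdot y=0_T$ if $x=y$ or $\{x,y\}\cap\{0_T,\infty_T\}\neq\emptyset$. No finiteness or infiniteness of $T$ is assumed. A semitopological semigroup is a semigroup $S$ endowed with a topology such that for every $a\in S$ the shifts $S\to S$, $x\mapsto ax$, and $S\to S$, $x\mapsto xa$, are continuous. A topological semigroup is a semigroup $S$ endowed with a topology such that the operation $S\times S\to S$ is (jointly) continuous. No separation axiom is included in these definitions. A semitopological semigroup $S$ is called square-topological if the map $S\to S$, $x\mapsto x^2$, is continuous. The separation axiom $T_1$ means that all singletons are closed. A semigroup $S$ is algebraically complete in a class $\mathscr{S}$ of semitopological semigroups if $S$ is a closed subsemigroup in each semitopological semigroup $X\in\mathscr{S}$ containing $S$ as a subsemigroup (containment is meant algebraically: $S\subset X$ and the operation of $S$ is the restriction of that of $X$; no topology on $S$ is prescribed in advance). *)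

(* Defs.v *)
(* MathComp / MathComp-Analysis. *)
From HB Require Import structures.
From mathcomp Require Import all_boot.
From mathcomp Require Import boolp classical_sets topology.

Set Implicit Arguments.
Unset Strict Implicit.
Unset Printing Implicit Defensive.

Local Open Scope classical_set_scope.
Local Open Scope group_scope.

Definition Taimanov (T : semigroupType) : Prop :=
  exists zero infty : T, [/\ zero <> infty,
    forall x y : T, x <> y -> ~ [set zero; infty] x -> ~ [set zero; infty] y ->
      x * y = infty
  & forall x y : T, x = y \/ [set x; y] `&` [set zero; infty] !=set0 ->
      x * y = zero].

(* A topology and an associative product with no compatibility between them:
   the compatibility conditions are the predicates below. *)
#[short(type="preTopologicalSemigroupType")]
HB.structure Definition PreTopologicalSemigroup :=
  {X of Topological X & Semigroup X}.

Definition semitopological_semigroup (X : preTopologicalSemigroupType) : Prop :=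
  forall a : X,
    continuous (fun x : X => a * x) /\ continuous (fun x : X => x * a).

Definition topological_semigroup (X : preTopologicalSemigroupType) : Prop :=
  continuous (fun p : X * X => p.1 * p.2).

Definition square_topological_semigroup (X : preTopologicalSemigroupType) :
    Prop :=
  semitopological_semigroup X /\ continuous (fun x : X => x * x).

Definition T1_space (X : topologicalType) : Prop := forall x : X, closed [set x].

Lemma T1_spaceP (X : topologicalType) : T1_space X <-> accessible_space X.
Proof.
split=> [X1 x y xy|]; last exact: accessible_closed_set1.
exists (~` [set y]); split; first exact/closed_openC/X1.
  by rewrite inE /=; exact/eqP.
by rewrite inE /= => /(_ erefl).
Qed.

Lemma topological_semigroup_square (X : preTopologicalSemigroupType) :
  topological_semigroup X -> square_topological_semigroup X.
Proof.
move=> mulC; split=> [a|x]; first split=> x.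
- apply: (@continuous_comp X (X * X)%type X (fun y => (a, y))
    (fun p => p.1 * p.2)); last exact: mulC.
  by apply: cvg_pair => /=; [exact: cvg_cst|exact: cvg_id].
- apply: (@continuous_comp X (X * X)%type X (fun y => (y, a))
    (fun p => p.1 * p.2)); last exact: mulC.
  by apply: cvg_pair => /=; [exact: cvg_id|exact: cvg_cst].
- apply: (@continuous_comp X (X * X)%type X (fun y => (y, y))
    (fun p => p.1 * p.2)); last exact: mulC.
  by apply: cvg_pair => /=; exact: cvg_id.
Qed.

(* "X contains S as a subsemigroup" is an injective homomorphism S -> X, with
   S identified with its image; S carries no topology of its own. The class C
   is meant to consist of semitopological semigroups. *)
Definition algebraically_complete (C : preTopologicalSemigroupType -> Prop)
    (S : semigroupType) : Prop :=
  forall X : preTopologicalSemigroupType, C X ->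
  forall f : {multiplicative S -> X}, injective f -> closed (range f).

(* Main.v *)
(* Let x be a point of the closure of T outside T. As X is T1, x is also adherent
   to T minus any finite set, so t x = oo for each t in T \ {0, oo}, since t y = oo
   for all but three y in T. Letting t tend to x gives x x = oo. But all squares
   of T are 0, so continuity of the square map gives x x = 0. *)
Require Import Defs.
From HB Require Import structures.
From mathcomp Require Import all_boot.
From mathcomp Require Import boolp classical_sets topology.

Set Implicit Arguments.
Unset Strict Implicit.
Unset Printing Implicit Defensive.

Local Open Scope classical_set_scope.
Local Open Scope group_scope.

(** The union of [F] and [C] is closed, so it contains the closure of [A]. This serves to carry an
    equation [C] from [A] to an adherent point, [F] being a finite set of exceptions. *)
Lemma closure_subU_closed (X : topologicalType) (A F C : set X) (x : X) :
  closed F -> closed C -> A `<=` F `|` C -> closure A x -> ~ F x -> C x.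
Proof.
move=> clF clC AFC Ax nFx.
have /closure_id clFC := closedU clF clC.
by have := closureS AFC Ax; rewrite -clFC => -[].
Qed.

Lemma closed_fiber (X Y : topologicalType) (g : X -> Y) (y : Y) :
  T1_space Y -> continuous g -> closed [set x | g x = y].
Proof. by move=> Y1 gC; apply: (@preimage_closed _ _ g [set y]) => // x _; exact: gC. Qed.

Lemma Taimanov_complete_square (T : semigroupType) : Taimanov T ->
  algebraically_complete
    (fun X => square_topological_semigroup X /\ T1_space X) T.
Proof.
move=> [z [o [zo mulo mulz]]] X [[mulC sqC] X1] f f_inj x clx.
apply: contrapT => nTx.
have nx t : x <> f t by move=> xt; apply: nTx; exists t.
have clzo : closed [set f z; f o] by apply: closedU; exact: X1.
have nzo : ~ [set f z; f o] x by case; exact: nx.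
have tx t : ~ [set z; o] t -> f t * x = f o.
  (* The exceptions are the images of those [s] with [t * s = z]: [z], [o] and [t] itself. *)
  move=> nt; apply: (@closure_subU_closed _ (range f)
    ([set f z; f o] `|` [set f t]) [set y | f t * y = f o]) => //.
  - exact: closedU.
  - exact: closed_fiber (mulC (f t)).1.
  - move=> _ [s _ <-]; have [|ns] := pselect ([set z; o] s).
      by case=> ->; left; left; [left|right].
    have [->|ts] := pselect (t = s); first by left; right.
    by right; rewrite /= -gmulfM mulo.
  - by case=> //; exact: nx.
have xxo : x * x = f o.
  (* Now the right factor [x] is fixed and the left one varies; [tx] leaves only [f z] and [f o] as
     possible exceptions. *)
  apply: (@closure_subU_closed _ (range f)
    [set f z; f o] [set y | y * x = f o]) => //.
  - exact: closed_fiber (mulC x).2.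
  - move=> _ [s _ <-]; have [|ns] := pselect ([set z; o] s).
      by case=> ->; left; [left|right].
    by right; exact: tx.
have xxz : x * x = f z.
  (* Every square in [T] is [z], so nothing has to be excepted. *)
  apply: (@closure_subU_closed _ (range f) set0 [set y | y * y = f z]) => //.
  - exact: closed0.
  - exact: closed_fiber sqC.
  - by move=> _ [s _ <-]; right; rewrite /= -gmulfM mulz //; left.
by apply/zo/f_inj; rewrite -xxz.
Qed.

Theorem corollary2 (T : semigroupType) (hT : Taimanov T) :
  algebraically_complete
    (fun X => square_topological_semigroup X /\ T1_space X) T /\
  algebraically_complete
    (fun X => topological_semigroup X /\ T1_space X) T.
Proof.
have cT := Taimanov_complete_square hT; split=> // X [mulC X1].
by apply: cT; split=> //; exact: topological_semigroup_square.
Qed.
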